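(* Fix $E_{\rm c}>0$, $T>0$ and an initial vector $\Phi^0\in\mathbb{C}^{|\mathcal{I}_{E_{\rm c}}|}$. Let $H=D+V^1+V^2$ be the plane wave Hamiltonian matrix with energy cutoff $E_{\rm c}$ of the two-layer incommensurate system, and let $\Phi(t)$ be the solution of $$\frac{\mathrm{d}\Phi(t)}{\mathrm{d}t}=-iH\Phi(t),\qquad \Phi(0)=\Phi^0 .$$ For a time step $\tau>0$ let $\Phi^k$ be obtained from $\Phi^0$ by the backward Euler based operator splitting scheme $$\Phi^{k+1/2}=\Big(I+i\tau\big(\tfrac12D+V^1\big)\Big)^{-1}\Phi^k,\qquad \Phi^{k+1}=\Big(I+i\tau\big(\tfrac12D+V^2\big)\Big)^{-1}\Phi^{k+1/2},\qquad k=0,1,2,\dots$$ Then there exist positive constants $\tau_0$ and $C_T$ (with $C_T$ depending on $T$ but independent of $\tau$) such that $$\|\Phi(t_k)-\Phi^k\|_{\ell_2}\leq C_T\,\tau$$ for any time step $0<\tau<\tau_0$ and every $t_k=k\tau\in[0,T]$.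
   Context: Let $d\in\{1,2\}$ and let $A_1,A_2\in\mathbb{R}^{d\times d}$ be invertible. For $j=1,2$ put $\mathcal{R}_j=\{A_jn:n\in\mathbb{Z}^d\}$, $\Gamma_j=\{A_j\alpha:\alpha\in[0,1)^d\}$, $\mathcal{R}_j^*=\{2\pi A_j^{-T}n:n\in\mathbb{Z}^d\}$ and $G_{jm}=2\pi A_j^{-T}m$ for $m\in\mathbb{Z}^d$. The lattices are assumed incommensurate: for $\gamma\in\mathbb{R}^d$, $\gamma+(\mathcal{R}_1^*\cup\mathcal{R}_2^* )=\mathcal{R}_1^*\cup\mathcal{R}_2^*$ if and only if $\gamma=0$. For $j=1,2$, $v_j\in L^2_{\rm loc}(\mathbb{R}^d)$ is a real-valued $\mathcal{R}_j$-periodic potential, with Fourier coefficients $\hat v^{(j)}_m=\frac{1}{|\Gamma_j|}\int_{\Gamma_j}v_j(x)e^{-iG_{jm}\cdot x}\,\mathrm{d}x$, $m\in\mathbb{Z}^d$. For an energy cutoff $E_{\rm c}>0$ let $\mathcal{I}^{j}_{E_{\rm c}}=\{m\in\mathbb{Z}^d:|G_{jm}|^2\le 2E_{\rm c}\}$ ($j=1,2$) and $\mathcal{I}_{E_{\rm c}}=\mathcal{I}^1_{E_{\rm c}}\times\mathcal{I}^2_{E_{\rm c}}$, a finite set. Vectors in $\mathbb{C}^{|\mathcal{I}_{E_{\rm c}}|}$ are indexed by $(m,n)\in\mathcal{I}_{E_{\rm c}}$. The matrices $D,V^1,V^2\in\mathbb{C}^{|\mathcal{I}_{E_{\rm c}}|\times|\mathcal{I}_{E_{\rm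 c}}|}$ have entries, for $(m,n),(m',n')\in\mathcal{I}_{E_{\rm c}}$, $$D_{mn,m'n'}=\tfrac12|G_{1m}+G_{2n}|^2\delta_{mm'}\delta_{nn'},\quad V^1_{mn,m'n'}=\hat v^{(1)}_{m-m'}\delta_{nn'},\quad V^2_{mn,m'n'}=\hat v^{(2)}_{n-n'}\delta_{mm'},$$ and $I$ is the identity matrix. The matrix $H=D+V^1+V^2$ is Hermitian. *)

(* Defs.v *)
From HB Require Import structures.
From mathcomp Require Import all_boot all_order all_algebra.
From mathcomp Require Import finmap.
From mathcomp Require Import all_classical all_reals all_analysis.
From mathcomp Require Import ring lra zify.
From mathcomp Require Export complex.
Import Order.TTheory GRing.Theory Num.Theory.
Import numFieldNormedType.Exports.

Set Implicit Arguments.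
Unset Strict Implicit.
Unset Printing Implicit Defensive.

Local Open Scope classical_set_scope.
Local Open Scope ring_scope.

Definition measure_cV_display : measure_display -> measure_display.
Proof. exact. Qed.

(* The product sigma-algebra, generated by the coordinate projections, as the
   library does for [n.-tuple T]; for [T = R] these are the Borel sets. *)
Section measurable_cV.
Context {d : measure_display} {T : measurableType d}.
Variable n : nat.

Let coors : 'I_n -> 'cV[T]_n -> T := fun i x => x i ord0.

Let cV_set0 : g_sigma_preimage coors set0.
Proof. exact: sigma_algebra0. Qed.

Let cV_setC A : g_sigma_preimage coors A -> g_sigma_preimage coors (~` A).
Proof. exact: sigma_algebraC. Qed.

Let cV_bigcup (F : _^nat) : (forall i, g_sigma_preimage coors (F i)) ->
  g_sigma_preimage coors (\bigcup_i (F i)).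
Proof. exact: sigma_algebra_bigcup. Qed.

HB.instance Definition _ := @isMeasurable.Build (measure_cV_display d)
  'cV[T]_n (g_sigma_preimage coors) cV_set0 cV_setC cV_bigcup.

End measurable_cV.

Lemma measurable_cV_coord d (T : measurableType d) n (i : 'I_n) :
  measurable_fun [set: 'cV[T]_n] (fun x : 'cV[T]_n => x i ord0).
Proof.
move=> _ Y mY; rewrite setTI; apply: sub_sigma_algebra => /=.
rewrite -bigcup_seq/=; exists i => /=; first by rewrite mem_index_enum.
by exists Y => //; rewrite setTI.
Qed.

Lemma measurable_fun_cVP d1 d2 (T1 : measurableType d1) (T2 : measurableType d2)
    n (f : T1 -> 'cV[T2]_n) :
  measurable_fun [set: T1] f <->
  forall i, measurable_fun [set: T1] (fun x => f x i ord0).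
Proof.
split=> [mf i|mf].
  exact: (measurableT_comp (@measurable_cV_coord _ T2 n i)).
move=> _ Y; rewrite setTI.
suff : (@measurable _ 'cV[T2]_n) `<=` [set A | measurable (f @^-1` A)].
  by apply.
apply: smallest_sub.
  split => /=.
  - by rewrite preimage_set0.
  - by move=> A mA; rewrite setTD preimage_setC; exact: measurableC.
  - by move=> F mF; rewrite preimage_bigcup; exact: bigcup_measurable.
rewrite -bigcup_seq => A [i _ [B mB <-]] /=.
rewrite setTI; have := mf i measurableT B mB; rewrite setTI; exact.
Qed.

Section cons_cV.
Context {R : realType} (n : nat).

Definition cons_cV (p : measurableTypeR R * 'cV[R]_n) : 'cV[R]_n.+1 := col_mx p.1%:M p.2.

Definition uncons_cV (x : 'cV[R]_n.+1) : measurableTypeR R * 'cV[R]_n :=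
  (x ord0 ord0, dsubmx (x : 'cV[R]_(1 + n))).

Lemma cons_cVK : cancel cons_cV uncons_cV.
Proof.
move=> [a x]; rewrite /uncons_cV/cons_cV/= col_mxKd; congr (_, _).
rewrite (_ : ord0 = lshift n (ord0 : 'I_1)); last exact/val_inj.
by rewrite (@col_mxEu R 1 n 1) mxE.
Qed.

Lemma uncons_cVK : cancel uncons_cV cons_cV.
Proof.
move=> x; apply: etrans (@vsubmxK R 1 n 1 x); rewrite /cons_cV/=.
suff -> : (x ord0 ord0)%:M = usubmx (x : 'cV[R]_(1 + n)) by [].
apply/matrixP => i j; rewrite !ord1 !mxE mulr1n.
by congr (x _ _); apply/val_inj.
Qed.

Lemma measurable_cons_cV : measurable_fun [set: measurableTypeR R * 'cV[R]_n] cons_cV.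
Proof.
apply/(@measurable_fun_cVP _ _ (measurableTypeR R * 'cV[R]_n)%type R) => i.
rewrite /cons_cV; case: (@splitP 1 n i) => [j ij|k ik].
  have -> : i = lshift n j by apply/val_inj.
  under eq_fun do rewrite (@col_mxEu R 1 n 1) ord1 mxE eqxx mulr1n.
  exact: measurable_fst.
have -> : i = rshift 1 k by apply/val_inj.
under eq_fun do rewrite (@col_mxEd R 1 n 1).
exact: (measurableT_comp (@measurable_cV_coord _ R n k)).
Qed.

Lemma measurable_uncons_cV : measurable_fun [set: 'cV[R]_n.+1] uncons_cV.
Proof.
apply: measurable_fun_pair => /=; first exact: (@measurable_cV_coord _ R n.+1).
apply/(@measurable_fun_cVP _ _ 'cV[R]_n.+1 R) => i.
under eq_fun do rewrite mxE.
exact: (@measurable_cV_coord _ R n.+1).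
Qed.

End cons_cV.

Section cons_measure.
Context {R : realType} (n : nat).
Variable mu : {sigma_finite_measure set 'cV[R]_n -> \bar R}.

(* Image of [lebesgue_measure \x mu] under the identification of R x R^n with
   R^n.+1. *)
Definition cons_measure : set 'cV[R]_n.+1 -> \bar R :=
  pushforward (lebesgue_measure \x mu)%E (@cons_cV R n).

Let m : {measure set 'cV[R]_n.+1 -> \bar R} :=
  measure_function_pushforward__canonical__measure_function_Measure
    (lebesgue_measure \x mu)%E (@measurable_cons_cV R n).

HB.instance Definition _ := isMeasure.Build _ _ _ cons_measure
  (measure0 m) (measure_ge0 m) (@measure_semi_sigma_additive _ _ _ m).

Lemma cons_measure_sigma_finite : sigma_finite setT cons_measure.
Proof.
have /sigma_finiteP[F [FT ndF Foo]] := sigma_finiteT (@lebesgue_measure R).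
have /sigma_finiteP[G [GT ndG Goo]] := sigma_finiteT mu.
exists (fun k => @uncons_cV R n @^-1` (F k `*` G k)).
  rewrite -preimage_bigcup (_ : \bigcup_k _ = setT) ?preimage_setT//.
  rewrite -subTset => -[x y] _.
  have [i _ Fx] : (\bigcup_i F i) x by rewrite -FT.
  have [j _ Gy] : (\bigcup_i G i) y by rewrite -GT.
  exists (maxn i j) => //; split => /=.
    by move: x Fx; exact/subsetPset/ndF/leq_maxl.
  by move: y Gy; exact/subsetPset/ndG/leq_maxr.
move=> k; have [mF Fk] := Foo k; have [mG Gk] := Goo k; split.
  rewrite -[X in measurable X]setTI; apply: measurable_uncons_cV => //.
  exact: measurableX.
rewrite /cons_measure /pushforward -comp_preimage.
rewrite (_ : _ \o _ = id) ?preimage_id; last first.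
  by apply/funext => x; exact: cons_cVK.
by rewrite product_measure1E// lte_mul_pinfty// ge0_fin_numE.
Qed.

HB.instance Definition _ := Measure_isSigmaFinite.Build _ _ _ cons_measure
  cons_measure_sigma_finite.

End cons_measure.

(* Lebesgue measure on R^n; R^0 is a single point of mass 1. *)
Fixpoint lebesgue_cV (R : realType) (n : nat) :
    {sigma_finite_measure set 'cV[R]_n -> \bar R} :=
  match n with
  | 0 => [the {sigma_finite_measure set _ -> \bar R} of @dirac _ 'cV[R]_0 0 R]
  | n.+1 => [the {sigma_finite_measure set _ -> \bar R} of
             cons_measure (lebesgue_cV R n)]
  end.

Section lattices.
Context {R : realType} {d : nat}.
Implicit Types (A : 'M[R]_d) (v : 'cV[R]_d -> R) (m : 'cV[int]_d).

Definition dotc (x y : 'cV[R]_d) : R := \sum_(i < d) x i ord0 * y i ord0.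

Definition intv m : 'cV[R]_d := map_mx intr m.

Definition bravais A : set 'cV[R]_d := [set A *m intv n | n in [set: 'cV[int]_d]].

Definition unit_cell A : set 'cV[R]_d :=
  [set A *m a | a in [set a : 'cV[R]_d | forall i, 0 <= a i ord0 < 1]].

Definition recip A m : 'cV[R]_d := (2 * pi) *: ((invmx A)^T *m intv m).

Definition recip_lattice A : set 'cV[R]_d := range (recip A).

Definition incommensurate A1 A2 : Prop :=
  forall g : 'cV[R]_d,
    [set g + x | x in recip_lattice A1 `|` recip_lattice A2]
      = recip_lattice A1 `|` recip_lattice A2 <-> g = 0.

(* An element of L^2_loc is given by a representative; every Lebesgue
   measurable function has a Borel measurable one. *)
Definition L2loc v : Prop :=
  measurable_fun setT v /\
  forall K : set 'cV[R]_d, compact K ->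
    (\int[lebesgue_cV R d]_(x in K) ((v x) ^+ 2)%:E < +oo)%E.

(* Periodicity is required almost everywhere because [v] is a representative of
   a class in L^2_loc. *)
Definition lattice_periodic A v : Prop :=
  forall r, bravais A r ->
    {ae lebesgue_cV R d, forall x, v (x + r) = v x}.

(* e^{-i G.x} is expanded as cos (G.x) - i sin (G.x). *)
Definition fourier_coef A v m : R[i] :=
  let mu := lebesgue_cV R d in
  let vol := fine (mu (unit_cell A)) in
  Complex (vol^-1 * \int[mu]_(x in unit_cell A) (v x * cos (dotc (recip A m) x)))
          (- (vol^-1 *
              \int[mu]_(x in unit_cell A) (v x * sin (dotc (recip A m) x)))).

Definition cutoff A (Ec : R) : set 'cV[int]_d :=
  [set m | dotc (recip A m) (recip A m) <= 2 * Ec].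

Lemma finite_cutoff A Ec : A \in unitmx -> finite_set (cutoff A Ec).
Proof.
move=> uA.
pose S := \sum_(i < d) \sum_(j < d) `|A j i| * (2 * Ec + 1).
have bnd m (i : 'I_d) : cutoff A Ec m -> `|(m i ord0)%:~R : R| <= S.
  rewrite /cutoff /= => mE; set G := recip A m.
  have Gj j : `|G j ord0| <= 2 * Ec + 1.
    have G2 : G j ord0 ^+ 2 <= 2 * Ec.
      apply: le_trans mE; rewrite /dotc (bigD1 j)//= expr2 lerDl.
      by apply: sumr_ge0 => k _; rewrite -expr2 sqr_ge0.
    by rewrite ler_norml; apply/andP; split; nra.
  have GA : (2 * pi) *: intv m = A^T *m G.
    rewrite -scalemxAr mulmxA -trmx_mul mulVmx// trmx1 mul1mx.
    by [].
  have pi2 : 1 <= 2 * pi :> R by have := @pi_ge2 R; lra.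
  have -> : (m i ord0)%:~R = intv m i ord0 :> R by rewrite mxE.
  apply: (@le_trans _ _ `|((2 * pi) *: intv m) i ord0|).
    rewrite [X in _ <= `|X|]mxE normrM ler_peMl// ger0_norm//; lra.
  rewrite GA mxE; apply: le_trans (ler_norm_sum _ _ _) _.
  rewrite /S [leRHS](bigD1 i)//=; apply: ler_wpDr; last first.
    by apply: ler_sum => j _; rewrite normrM mxE ler_wpM2l.
  apply: sumr_ge0 => k _; apply: sumr_ge0 => j _.
  by rewrite mulr_ge0// (le_trans _ (Gj j)).
pose B := (Num.truncn S).+1.
pose f (g : {ffun 'I_d -> 'I_B.*2.+1}) : 'cV[int]_d :=
  \col_i ((g i : nat)%:Z - B%:Z).
apply: (@sub_finite_set _ _ (f @` setT)); last exact/finite_image.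
move=> m mE; exists [ffun i => inord (absz (m i ord0 + B%:Z))] => //.
apply/matrixP => i j; rewrite mxE ffunE (ord1 j).
have mB : `|m i ord0| <= B%:Z.
  rewrite -(ler_int R) intr_norm; apply: le_trans (bnd m i mE) _.
  by rewrite ltW// truncnS_gt.
move: mB; rewrite ler_norml => /andP[].
by move: (m i ord0) (B) => z b h1 h2; rewrite inordK; lia.
Qed.

(* [fset_set] returns the empty set on infinite sets; [finite_cutoff] rules this
   case out. *)
Definition pw_index A1 A2 (Ec : R) : {fset 'cV[int]_d * 'cV[int]_d} :=
  fset_set (cutoff A1 Ec `*` cutoff A2 Ec).

Lemma in_pw_index A1 A2 Ec p : A1 \in unitmx -> A2 \in unitmx ->
  p \in pw_index A1 A2 Ec <-> cutoff A1 Ec p.1 /\ cutoff A2 Ec p.2.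
Proof.
move=> uA1 uA2; rewrite /pw_index in_fset_set.
  by rewrite inE.
by apply: finite_setX; exact: finite_cutoff.
Qed.

(* Vectors and matrices are indexed by ['I_#|{: pw_index A1 A2 Ec}|];
   [pw k] is the pair (m, n) with number [k]. *)
Definition pw_dim A1 A2 Ec : nat := #|{: pw_index A1 A2 Ec}|.

Definition pw A1 A2 Ec (k : 'I_(pw_dim A1 A2 Ec)) : 'cV[int]_d * 'cV[int]_d :=
  fsval (enum_val k).

Definition pwD A1 A2 Ec : 'M[R[i]]_(pw_dim A1 A2 Ec) :=
  \matrix_(k, l)
    let: (m, n) := pw k in let: (m', n') := pw l in
    let G := recip A1 m + recip A2 n in
    (2^-1 * dotc G G)%:C%C * (m == m')%:R * (n == n')%:R.

Definition pwV1 A1 A2 v1 Ec : 'M[R[i]]_(pw_dim A1 A2 Ec) :=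
  \matrix_(k, l)
    let: (m, n) := pw k in let: (m', n') := pw l in
    fourier_coef A1 v1 (m - m') * (n == n')%:R.

Definition pwV2 A1 A2 v2 Ec : 'M[R[i]]_(pw_dim A1 A2 Ec) :=
  \matrix_(k, l)
    let: (m, n) := pw k in let: (m', n') := pw l in
    fourier_coef A2 v2 (n - n') * (m == m')%:R.

Definition pwH A1 A2 v1 v2 Ec : 'M[R[i]]_(pw_dim A1 A2 Ec) :=
  pwD A1 A2 Ec + pwV1 A1 A2 v1 Ec + pwV2 A1 A2 v2 Ec.

End lattices.

Section evolution.
Context {R : realType} {N : nat}.

Definition l2norm (x : 'cV[R[i]]_N) : R :=
  Num.sqrt (\sum_(k < N) ComplexField.Normc.normc (x k ord0) ^+ 2).

(* The derivative of a complex-valued function of a real variable is taken on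
   real and imaginary parts, [R[i]] being a normed module over itself only. *)
Definition is_derive_cV (f : R -> 'cV[R[i]]_N) (t : R) (df : 'cV[R[i]]_N) : Prop :=
  forall k, is_derive t (1 : R) (fun s => complex.Re (f s k ord0)) (complex.Re (df k ord0))
    /\ is_derive t (1 : R) (fun s => complex.Im (f s k ord0)) (complex.Im (df k ord0)).

Definition continuous_on_cV (B : set R) (f : R -> 'cV[R[i]]_N) : Prop :=
  forall k, {within B, continuous (fun s => complex.Re (f s k ord0))}
    /\ {within B, continuous (fun s => complex.Im (f s k ord0))}.

(* A classical solution on [0, T]: the derivative is required in the interior
   and continuity up to the end points. *)
Definition schrodinger_solution (H : 'M[R[i]]_N) (Phi0 : 'cV[R[i]]_N) (T : R)
    (Phi : R -> 'cV[R[i]]_N) : Prop :=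
  [/\ continuous_on_cV `[0, T] Phi,
      forall t, 0 < t < T -> is_derive_cV Phi t ((- 'i%C) *: (H *m Phi t))
    & Phi 0 = Phi0].

(* [invmx] is the identity on singular matrices; the matrices below are
   invertible for every real [tau] when D, V1, V2 are Hermitian. *)
Definition splitting_step (D V1 V2 : 'M[R[i]]_N) (tau : R) (x : 'cV[R[i]]_N) :
    'cV[R[i]]_N :=
  let half := invmx (1%:M + ('i%C * tau%:C%C) *: (2^-1 *: D + V1)) *m x in
  invmx (1%:M + ('i%C * tau%:C%C) *: (2^-1 *: D + V2)) *m half.

Definition splitting_scheme (D V1 V2 : 'M[R[i]]_N) (tau : R) (Phi0 : 'cV[R[i]]_N)
    (k : nat) : 'cV[R[i]]_N :=
  iter k (splitting_step D V1 V2 tau) Phi0.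

End evolution.

(* Main.v *)
(** Write [H = A + B] with [A = D/2 + V1], [B = D/2 + V2]. One step of the scheme
    solves [(I + i tau A)(I + i tau B) Phi^(k+1) = Phi^k], and
    [(I + i tau A)(I + i tau B) = I + i tau H - tau^2 A B], so the exact solution
    satisfies the same recursion up to [O(tau^2)]: the backward Euler defect plus
    [tau^2 A B Phi]. As [|(I + i tau A) x| >= (1 - tau |A|) |x|], both factors are
    invertible for small [tau] and their inverses amplify errors by at most
    [1 + O(tau)]; a discrete Gronwall argument sums the defects. *)
Require Import Defs.
From mathcomp Require Import all_boot all_order all_algebra.
From mathcomp Require Import all_classical all_reals all_analysis.
From mathcomp Require Import ring lra.
Import Order.TTheory GRing.Theory Num.Theory.
Import numFieldNormedType.Exports.

Set Implicit Arguments.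
Unset Strict Implicit.
Unset Printing Implicit Defensive.

Local Open Scope classical_set_scope.
Local Open Scope ring_scope.

(** * A submultiplicative 1-norm on complex vectors and matrices *)

Section norm1.
Context {R : realType}.
Implicit Types (z : R[i]) (N : nat).

(** Replaces the modulus because derivatives of the solution are given on real and imaginary parts.
    It dominates the modulus and is still subadditive and submultiplicative. *)
Definition cabs1 z : R := `|complex.Re z| + `|complex.Im z|.

Definition norm1 N (x : 'cV[R[i]]_N) : R := \sum_(k < N) cabs1 (x k ord0).

(** Coarser than the operator norm induced by [norm1], but compatible with it, which suffices for a
    rate in [tau]. *)
Definition mxnorm1 N (A : 'M[R[i]]_N) : R := \sum_(k < N) \sum_(l < N) cabs1 (A k l).

Lemma cabs1_ge0 z : 0 <= cabs1 z.
Proof. by rewrite addr_ge0. Qed.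

Lemma cabs1D y z : cabs1 (y + z) <= cabs1 y + cabs1 z.
Proof.
case: y z => [a b] [c e]; rewrite /cabs1 /= addrACA.
by rewrite lerD// ler_normD.
Qed.

Lemma cabs1N z : cabs1 (- z) = cabs1 z.
Proof. by case: z => a b; rewrite /cabs1 /= !normrN. Qed.

Lemma cabs1M y z : cabs1 (y * z) <= cabs1 y * cabs1 z.
Proof.
case: y z => [a b] [c e]; rewrite /cabs1 /=.
have h1 := ler_normB (a * c) (b * e).
have h2 := ler_normD (a * e) (b * c).
rewrite !normrM in h1 h2; nra.
Qed.

Lemma cabs1_eq0 z : cabs1 z = 0 -> z = 0.
Proof.
case: z => a b; rewrite /cabs1 /= => /eqP.
by rewrite paddr_eq0// !normr_eq0 => /andP[/eqP -> /eqP ->].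
Qed.

Lemma cabs1_sum (I : Type) (r : seq I) (P : pred I) (F : I -> R[i]) :
  cabs1 (\sum_(j <- r | P j) F j) <= \sum_(j <- r | P j) cabs1 (F j).
Proof.
elim/big_ind2: _ => [|x1 x2 y1 y2 h1 h2|//].
  by rewrite /cabs1 /= normr0 addr0.
by apply: le_trans (cabs1D _ _) _; exact: lerD.
Qed.

Lemma normc_le_cabs1 z : ComplexField.Normc.normc z <= cabs1 z.
Proof.
case: z => a b; rewrite /cabs1 /=.
rewrite -[leRHS]ger0_norm ?addr_ge0// -sqrtr_sqr ler_wsqrtr//.
rewrite -(real_normK (num_real a)) -(real_normK (num_real b)) sqrrD.
by rewrite addrAC lerDl mulrn_wge0// mulr_ge0.
Qed.

Lemma norm1_ge0 N (x : 'cV[R[i]]_N) : 0 <= norm1 x.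
Proof. by apply: sumr_ge0 => k _; exact: cabs1_ge0. Qed.

Lemma mxnorm1_ge0 N (A : 'M[R[i]]_N) : 0 <= mxnorm1 A.
Proof. by apply: sumr_ge0 => k _; apply: sumr_ge0 => l _; exact: cabs1_ge0. Qed.

Lemma norm10 N : norm1 (0 : 'cV[R[i]]_N) = 0.
Proof. by apply: big1 => k _; rewrite mxE /cabs1 /= normr0 addr0. Qed.

Lemma norm1D N (x y : 'cV[R[i]]_N) : norm1 (x + y) <= norm1 x + norm1 y.
Proof. by rewrite -big_split; apply: ler_sum => k _; rewrite mxE cabs1D. Qed.

Lemma norm1N N (x : 'cV[R[i]]_N) : norm1 (- x) = norm1 x.
Proof. by apply: eq_bigr => k _; rewrite mxE cabs1N. Qed.

Lemma lerB_norm1D N (x y : 'cV[R[i]]_N) : norm1 x - norm1 y <= norm1 (x + y).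
Proof.
rewrite lerBlDr -{1}(addrK y x) -(norm1N y).
exact: norm1D.
Qed.

Lemma norm1Z N z (x : 'cV[R[i]]_N) : norm1 (z *: x) <= cabs1 z * norm1 x.
Proof. by rewrite mulr_sumr; apply: ler_sum => k _; rewrite mxE cabs1M. Qed.

Lemma norm1_eq0 N (x : 'cV[R[i]]_N) : norm1 x = 0 -> x = 0.
Proof.
move=> /psumr_eq0P x0; apply/matrixP => k j; rewrite ord1 [RHS]mxE.
by apply: cabs1_eq0; apply: x0 => // l _; exact: cabs1_ge0.
Qed.

Lemma cabs1_le_norm1 N (x : 'cV[R[i]]_N) k : cabs1 (x k ord0) <= norm1 x.
Proof.
rewrite /norm1 (bigD1 k)//= lerDl.
by apply: sumr_ge0 => l _; exact: cabs1_ge0.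
Qed.

Lemma norm1_mulmx N (A : 'M[R[i]]_N) (x : 'cV[R[i]]_N) : norm1 (A *m x) <= mxnorm1 A * norm1 x.
Proof.
rewrite mulr_suml; apply: ler_sum => k _; rewrite mxE mulr_suml.
apply: le_trans (cabs1_sum _ _ _) _; apply: ler_sum => l _.
apply: le_trans (cabs1M _ _) _.
by rewrite ler_wpM2l ?cabs1_ge0// cabs1_le_norm1.
Qed.

(** Each squared modulus is at most [cabs1 (x k ord0) * norm1 x]; summing over [k] gives the square
    of [norm1 x]. This lets the whole error analysis run in [norm1]. *)
Lemma l2norm_le_norm1 N (x : 'cV[R[i]]_N) : l2norm x <= norm1 x.
Proof.
rewrite -[leRHS]ger0_norm ?norm1_ge0// -sqrtr_sqr ler_wsqrtr//.
rewrite [leRHS]expr2 {1}/norm1 mulr_suml; apply: ler_sum => k _.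
rewrite expr2; have n0 : 0 <= ComplexField.Normc.normc (x k ord0).
  by case: (x k ord0) => a b; exact: sqrtr_ge0.
apply: ler_pM => //; first exact: normc_le_cabs1.
by apply: le_trans (normc_le_cabs1 _) (cabs1_le_norm1 _ _).
Qed.

Lemma norm1_le_ReIm N (x : 'cV[R[i]]_N) (C : R) :
  (forall k, `|complex.Re (x k ord0)| <= C /\ `|complex.Im (x k ord0)| <= C) ->
  norm1 x <= 2 * N%:R * C.
Proof.
move=> h; apply: (@le_trans _ _ (\sum_(k < N) (2 * C))).
  by apply: ler_sum => k _; have [] := h k; rewrite /cabs1; lra.
by rewrite sumr_const card_ord -mulr_natl; lra.
Qed.

Lemma cabs1_i (r : R) : 0 <= r -> cabs1 ('i%C * r%:C%C) = r.
Proof.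
move=> r0; rewrite /cabs1 /= !(mul0r, mul1r, mulr0, addr0, add0r).
by rewrite oppr0 normr0 add0r ger0_norm.
Qed.

End norm1.

(** * Lower bounds and invertibility for the backward Euler factors *)

Section resolvent.
Context {R : realType} {N : nat}.
Implicit Types (A : 'M[R[i]]_N) (x : 'cV[R[i]]_N).

(** Reverse triangle inequality. It serves both for invertibility and, in the error recursion, in
    place of a bound on the inverse matrix. *)
Lemma euler_lower_bound A (tau : R) x : 0 <= tau ->
  (1 - tau * mxnorm1 A) * norm1 x <= norm1 ((1%:M + ('i%C * tau%:C%C) *: A) *m x).
Proof.
move=> tau0; rewrite mulmxDl mul1mx.
apply: le_trans (lerB_norm1D _ _); rewrite mulrBl mul1r lerB//.
rewrite -scalemxAl; apply: le_trans (norm1Z _ _) _.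
by rewrite cabs1_i// -mulrA ler_wpM2l// norm1_mulmx.
Qed.

Lemma euler_unitmx A (tau : R) : 0 <= tau -> tau * mxnorm1 A < 1 ->
  1%:M + ('i%C * tau%:C%C) *: A \in unitmx.
Proof.
(* [det0P] yields a row vector in the left kernel; transposing first turns it into a column vector
   killed by the Euler factor. *)
move=> tau0 tA1; rewrite -unitmx_tr unitmxE unitfE.
apply/negP => /det0P[v vn0 vA]; move/negP: vn0; apply.
have := euler_lower_bound A v^T tau0.
rewrite -[_ *m v^T]trmxK trmx_mul trmxK vA trmx0 norm10 => h.
have v0 : norm1 v^T = 0.
  by have := norm1_ge0 v^T; nra.
by rewrite -(trmxK v) (norm1_eq0 v0) trmx0.
Qed.

End resolvent.

(** * Mean value estimates for real functions on a segment *)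

Section backward_taylor.
Context {R : realType}.
Variables (f g : R -> R) (T : R).
Hypothesis fc : {within `[0, T], continuous f}.
Hypothesis fg : forall t : R, 0 < t < T -> is_derive t (1 : R) f (g t).

(** The intermediate point ranges over the closed segment, so that [s = t] is covered; hence the
    bounds on [g] below are also required at end points. *)
Lemma mvt_subsegment (s t : R) : 0 <= s -> s <= t -> t <= T ->
  exists2 c, s <= c <= t & f t - f s = g c * (t - s).
Proof.
move=> s0 st tT.
have fg' x : x \in `]s, t[%R -> is_derive x (1 : R) f (g x).
  rewrite in_itv/= => /andP[sx xt]; apply: fg.
  by rewrite (le_lt_trans s0 sx) (lt_le_trans xt tT).
have fc' : {within `[s, t], continuous f}.
  apply: (@continuous_subspaceW _ _ _ _ _ _ fc) => x /=.
  by rewrite !in_itv/= => /andP[sx xt]; rewrite (le_trans s0 sx) (le_trans xt tT).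
by have [c cst ->] := MVT_segment st fg' fc'; exists c; rewrite // -in_itv.
Qed.

Lemma lipschitz_of_derive (L s t : R) :
  (forall c, 0 <= c <= T -> `|g c| <= L) ->
  0 <= s -> s <= t -> t <= T -> `|f t - f s| <= L * (t - s).
Proof.
move=> gL s0 st tT; have [c /andP[sc ct] ->] := mvt_subsegment s0 st tT.
rewrite normrM [`|t - s|]ger0_norm ?subr_ge0//.
by rewrite ler_wpM2r ?subr_ge0// gL// (le_trans s0 sc) (le_trans ct tT).
Qed.

(** Expansion at the right end point, as in backward Euler. The mean value theorem and a Lipschitz
    bound on [g] replace a second derivative, at the price of [L] instead of [L / 2]. *)
Lemma backward_taylor (L s t : R) :
  (forall c, s <= c <= t -> `|g t - g c| <= L * (t - c)) -> 0 <= L ->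
  0 <= s -> s <= t -> t <= T ->
  `|f t - f s - (t - s) * g t| <= L * (t - s) ^+ 2.
Proof.
move=> gL L0 s0 st tT; have [c /andP[sc ct] ->] := mvt_subsegment s0 st tT.
have -> : g c * (t - s) - (t - s) * g t = - ((g t - g c) * (t - s)) by ring.
rewrite normrN normrM [`|t - s|]ger0_norm ?subr_ge0// expr2 mulrA.
rewrite ler_wpM2r ?subr_ge0//; apply: le_trans (gL c _) _; first by rewrite sc.
by rewrite ler_wpM2l// lerB.
Qed.

Lemma bounded_on_segment : exists M, forall t : R, 0 <= t <= T -> `|f t| <= M.
Proof.
have [T0|T0] := leP 0 T; last first.
  (* For [T < 0] the segment is empty and any bound works. *)
  by exists 0 => t /andP[t0 tT]; have := le_trans t0 tT; rewrite leNgt T0.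
have [a _ fa] := EVT_max T0 fc; have [b _ fb] := EVT_min T0 fc.
exists (`|f a| + `|f b|) => t tT.
have ht : t \in `[0, T]%R by rewrite in_itv.
have := fa t ht; have := fb t ht.
have := ler_norm (f a); have := ler_norm (- f b); rewrite normrN.
by have := normr_ge0 (f a); have := normr_ge0 (f b); rewrite ler_norml; lra.
Qed.

End backward_taylor.

(** * A priori bounds and backward Euler consistency for the exact solution *)

Section linear_ode.
Context {R : realType} {N : nat}.
Variables (H : 'M[R[i]]_N) (Phi0 : 'cV[R[i]]_N) (T : R) (Phi : R -> 'cV[R[i]]_N).
Hypothesis sol : schrodinger_solution H Phi0 T Phi.

Lemma solution_bounded :
  exists2 M, 0 <= M & forall t : R, 0 <= t <= T -> norm1 (Phi t) <= M.
Proof.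
have [Pc _ _] := sol.
have /choice[M1 h1] k := bounded_on_segment (proj1 (Pc k)).
have /choice[M2 h2] k := bounded_on_segment (proj2 (Pc k)).
(* The absolute value makes the bound nonnegative even when the segment is empty. *)
exists (`|\sum_k (M1 k + M2 k)|) => // t tT; apply: le_trans (ler_norm _).
by apply: ler_sum => k _; rewrite lerD ?h1 ?h2.
Qed.

Let G : 'M[R[i]]_N := (- 'i%C) *: H.

(** The derivative [G *m Phi t] is bounded because [Phi] is. *)
Lemma solution_lipschitz :
  exists2 L, 0 <= L & forall s t : R, 0 <= s -> s <= t -> t <= T ->
    norm1 (Phi t - Phi s) <= L * (t - s).
Proof.
have [Pc Pd _] := sol; have [M M0 PM] := solution_bounded.
have GM c k : 0 <= c <= T -> cabs1 ((G *m Phi c) k ord0) <= mxnorm1 G * M.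
  move=> cT; apply: le_trans (cabs1_le_norm1 _ _) _.
  apply: le_trans (norm1_mulmx _ _) _.
  by rewrite ler_wpM2l ?mxnorm1_ge0// PM.
exists (2 * N%:R * (mxnorm1 G * M)); first by rewrite !mulr_ge0 ?mxnorm1_ge0.
move=> s t s0 st tT; rewrite -[leRHS]mulrA; apply: norm1_le_ReIm => k.
rewrite !mxE; split.
- rewrite raddfD raddfN/=.
  apply: (@lipschitz_of_derive _ (fun s => complex.Re (Phi s k ord0))
    (fun c => complex.Re ((G *m Phi c) k ord0)) T) => //.
  + exact: (proj1 (Pc k)).
  + by move=> c /Pd /(_ k) []; rewrite -scalemxAl.
  + by move=> c /(GM c k); apply: le_trans; rewrite lerDl.
- rewrite raddfD raddfN/=.
  apply: (@lipschitz_of_derive _ (fun s => complex.Im (Phi s k ord0))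
    (fun c => complex.Im ((G *m Phi c) k ord0)) T) => //.
  + exact: (proj2 (Pc k)).
  + by move=> c /Pd /(_ k) []; rewrite -scalemxAl.
  + by move=> c /(GM c k); apply: le_trans; rewrite lerDr.
Qed.

(** The equation transfers the Lipschitz bound from [Phi] to its derivative [G *m Phi], so
    [backward_taylor] applies to every real and imaginary part. *)
Lemma backward_euler_consistency :
  exists2 K, 0 <= K & forall s tau : R, 0 <= s -> 0 <= tau -> s + tau <= T ->
    norm1 (Phi (s + tau) - Phi s + ('i%C * tau%:C%C) *: (H *m Phi (s + tau)))
    <= K * tau ^+ 2.
Proof.
have [Pc Pd _] := sol; have [L L0 PL] := solution_lipschitz.
have GL c t k : 0 <= c -> c <= t -> t <= T ->
    cabs1 ((G *m Phi t) k ord0 - (G *m Phi c) k ord0) <= mxnorm1 G * L * (t - c).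
  move=> c0 ct tT; rewrite -mulrA.
  have -> : (G *m Phi t) k ord0 - (G *m Phi c) k ord0 =
            (G *m (Phi t - Phi c)) k ord0 by rewrite mulmxBr !mxE.
  apply: le_trans (cabs1_le_norm1 _ _) _.
  apply: le_trans (norm1_mulmx _ _) _.
  by rewrite ler_wpM2l ?mxnorm1_ge0// PL.
have GL0 : 0 <= mxnorm1 G * L by rewrite mulr_ge0 ?mxnorm1_ge0.
exists (2 * N%:R * (mxnorm1 G * L)); first by rewrite !mulr_ge0 ?mxnorm1_ge0.
move=> s tau s0 tau0 tT; rewrite -[leRHS]mulrA; apply: norm1_le_ReIm => k.
set t := s + tau in tT *.
have st : s <= t by rewrite lerDl.
have tauE : tau = t - s by rewrite /t addrC addKr.
(* Written with [G], the defect is a Taylor remainder whose scalar [tau] is real and therefore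
   commutes with [Re] and [Im]. *)
have -> : Phi t - Phi s + ('i%C * tau%:C%C) *: (H *m Phi t) =
          Phi t - Phi s - tau%:C%C *: (G *m Phi t).
  by rewrite /G -scalemxAl scalerA -scaleNr mulrN opprK [_ * 'i%C]mulrC.
have ReM z : complex.Re (tau%:C%C * z) = tau * complex.Re z.
  by case: z => a b /=; rewrite mul0r subr0.
have ImM z : complex.Im (tau%:C%C * z) = tau * complex.Im z.
  by case: z => a b /=; rewrite mul0r addr0.
have -> : (Phi t - Phi s - tau%:C%C *: (G *m Phi t)) k ord0 =
          Phi t k ord0 - Phi s k ord0 - tau%:C%C * (G *m Phi t) k ord0.
  by move: (G *m Phi t) => y; rewrite !mxE.
split.
- rewrite !raddfD !raddfN/= ReM tauE.
  apply: (@backward_taylor _ (fun s => complex.Re (Phi s k ord0))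
    (fun c => complex.Re ((G *m Phi c) k ord0)) T) => //.
  + exact: (proj1 (Pc k)).
  + by move=> c /Pd /(_ k) []; rewrite -scalemxAl.
  + move=> c /andP[sc ct]; apply: le_trans (GL c t k (le_trans s0 sc) ct tT).
    by rewrite /cabs1 !raddfD !raddfN lerDl.
- rewrite !raddfD !raddfN/= ImM tauE.
  apply: (@backward_taylor _ (fun s => complex.Im (Phi s k ord0))
    (fun c => complex.Im ((G *m Phi c) k ord0)) T) => //.
  + exact: (proj2 (Pc k)).
  + by move=> c /Pd /(_ k) []; rewrite -scalemxAl.
  + move=> c /andP[sc ct]; apply: le_trans (GL c t k (le_trans s0 sc) ct tT).
    by rewrite /cabs1 !raddfD !raddfN lerDr.
Qed.

End linear_ode.

(** Discrete Gronwall inequality: [n] defects of size [K * tau ^+ 2], each amplified at most [n]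
    times by [1 + L * tau <= expR (L * tau)]. The bound [n%:R * tau <= T] absorbs one power of [tau]
    and the exponential growth. *)
Lemma discrete_gronwall (R : realType) (L T tau K : R) (e : nat -> R) (n : nat) :
  0 <= L -> 0 <= K -> 0 <= tau -> n%:R * tau <= T -> e 0 = 0 ->
  (forall k, (k < n)%N -> e k.+1 <= (1 + L * tau) * (e k + K * tau ^+ 2)) ->
  e n <= expR (L * T) * T * K * tau.
Proof.
move=> L0 K0 tau0 nT e0 step; set q := 1 + L * tau in step *.
have q1 : 1 <= q by rewrite lerDl mulr_ge0.
have main : forall k, (k <= n)%N -> e k <= q ^+ k * (k%:R * K * tau ^+ 2).
  elim=> [|k IH] kn; first by rewrite e0 !mul0r mulr0.
  apply: le_trans (step k kn) _.
  rewrite (exprS q) -[leRHS]mulrA ler_wpM2l ?(le_trans ler01 q1)//.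
  apply: le_trans (lerD (IH (ltnW kn)) (lexx _)) _.
  (* Since [q ^+ k >= 1], the newest defect may be charged the same amplification as the older
     ones. *)
  have qk : 1 <= q ^+ k by exact: exprn_ege1.
  have Kt : 0 <= K * tau ^+ 2 by rewrite mulr_ge0// exprn_ge0.
  rewrite -natr1 -subr_ge0.
  have -> : q ^+ k * ((k%:R + 1) * K * tau ^+ 2)
            - (q ^+ k * (k%:R * K * tau ^+ 2) + K * tau ^+ 2)
            = (q ^+ k - 1) * (K * tau ^+ 2) by ring.
  by rewrite mulr_ge0// subr_ge0.
apply: le_trans (main n (leqnn n)) _.
have -> : expR (L * T) * T * K * tau = expR (L * T) * (T * (K * tau)) by ring.
have -> : n%:R * K * tau ^+ 2 = (n%:R * tau) * (K * tau) by ring.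
have Kt0 : 0 <= K * tau by rewrite mulr_ge0.
apply: ler_pM.
- by rewrite exprn_ge0// (le_trans ler01 q1).
- by rewrite !mulr_ge0.
- apply: (@le_trans _ _ (expR (L * tau) ^+ n)).
    by rewrite lerXn2r ?nnegrE ?expR_ge0 ?(le_trans ler01 q1)// expR_ge1Dx.
  by rewrite -expRM_natl ler_expR mulrCA ler_wpM2l.
- by rewrite ler_wpM2r.
Qed.

(** * Error recursion and convergence of the splitting scheme *)

Section splitting.
Context {R : realType} {N : nat}.
Variables (D V1 V2 : 'M[R[i]]_N).
Let A := 2^-1 *: D + V1.
Let B := 2^-1 *: D + V2.

Lemma splitting_factorization (tau : R) (x : 'cV[R[i]]_N) :
  let z := 'i%C * tau%:C%C in
  (1%:M + z *: A) *m ((1%:M + z *: B) *m x) =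
  x + z *: ((D + V1 + V2) *m x) + (z * z) *: (A *m (B *m x)).
Proof.
move=> z.
have -> : D + V1 + V2 = A + B.
  rewrite /A /B addrACA -scalerDl -addrA; congr (_ + _).
  by rewrite -mulr2n -[_ *+ 2]mulr_natl mulfV ?scale1r// pnatr_eq0.
have stepE (C : 'M[R[i]]_N) (y : 'cV_N) : (1%:M + z *: C) *m y = y + z *: (C *m y).
  by rewrite mulmxDl mul1mx -scalemxAl.
rewrite !stepE mulmxDr -scalemxAr [(A + B) *m x]mulmxDl !scalerDr scalerA.
by rewrite [z *: (A *m x) + z *: (B *m x)]addrC !addrA.
Qed.

(** Smallness of [tau] makes both factors units, so [invmx] is a true inverse. The [B] solve comes
    last in a step and is thus undone first. *)
Lemma splitting_stepK (tau : R) (x : 'cV[R[i]]_N) :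
  0 <= tau -> tau * mxnorm1 A < 1 -> tau * mxnorm1 B < 1 ->
  let z := 'i%C * tau%:C%C in
  (1%:M + z *: A) *m ((1%:M + z *: B) *m splitting_step D V1 V2 tau x) = x.
Proof.
move=> tau0 hA hB z; rewrite /splitting_step.
by rewrite mulKVmx ?mulKVmx// euler_unitmx.
Qed.

Lemma splitting_convergence (Phi0 : 'cV[R[i]]_N) (T : R) (Phi : R -> 'cV[R[i]]_N) :
  schrodinger_solution (D + V1 + V2) Phi0 T Phi ->
  exists tau0 CT : R, [/\ 0 < tau0, 0 < CT &
    forall (tau : R) (k : nat), 0 < tau < tau0 -> k%:R * tau <= T ->
      l2norm (Phi (k%:R * tau) - splitting_scheme D V1 V2 tau Phi0 k)
      <= CT * tau].
Proof.
move=> sol; have [_ _ Phi_0] := sol.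
have [M M0 PM] := solution_bounded sol.
have [K1 K10 PK] := backward_euler_consistency sol.
have a0 := mxnorm1_ge0 A; have b0 := mxnorm1_ge0 B.
set a := mxnorm1 A in a0; set b := mxnorm1 B in b0.
pose L := 1 + a + b; have L1 : 1 <= L by rewrite /L; lra.
(* [K1] bounds the backward Euler defect, [a * (b * M)] the splitting term [A *m (B *m Phi t)]. *)
pose K := K1 + a * (b * M).
have K0 : 0 <= K by rewrite /K addr_ge0// !mulr_ge0.
pose C := expR (4 * L * T) * T * K.
(* This [tau0] forces [L * tau < 1/4], which gives invertibility and the amplification factor
   [1 + 4 * L * tau]. The form of the second witness makes it positive whatever the sign of [C]. *)
exists (4 * L)^-1, (`|C| + 1); split; first by rewrite invr_gt0; lra.
  by rewrite ltr_wpDl.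
move=> tau n /andP[tau_gt0 tau_lt] nT.
have tL : 4 * L * tau < 1 by rewrite mulrC -ltr_pdivlMr ?div1r //; lra.
have ta : tau * a <= tau * L by rewrite ler_wpM2l ?ltW//; rewrite /L; lra.
have tb : tau * b <= tau * L by rewrite ler_wpM2l ?ltW//; rewrite /L; lra.
have tau_ge0 := ltW tau_gt0.
have tL4 : 4 * (tau * L) < 1 by rewrite [tau * L]mulrC mulrA.
have ta1 : tau * a < 1 by lra.
have tb1 : tau * b < 1 by lra.
apply: le_trans (l2norm_le_norm1 _) _.
apply: (@le_trans _ _ (C * tau)); last first.
  by rewrite ler_wpM2r// (le_trans (ler_norm C))// lerDl.
pose e k := Phi (k%:R * tau) - splitting_scheme D V1 V2 tau Phi0 k.
apply: (@discrete_gronwall R (4 * L) T tau K (fun k => norm1 (e k)) n) => //.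
- by lra.
- by rewrite /e mul0r Phi_0 subrr norm10.
move=> k kn; set z := 'i%C * tau%:C%C.
have kT : k%:R * tau + tau <= T.
  apply: le_trans nT; rewrite -[X in _ + X]mul1r -mulrDl natr1.
  by rewrite ler_wpM2r// ler_nat.
have kE : k.+1%:R * tau = k%:R * tau + tau by rewrite -natr1 mulrDl mul1r.
have k0 : 0 <= k%:R * tau by rewrite mulr_ge0.
set t := k%:R * tau + tau in kT kE.
pose r := (Phi t - Phi (k%:R * tau) + z *: ((D + V1 + V2) *m Phi t))
          + (z * z) *: (A *m (B *m Phi t)).
(* The numerical step contributes the old iterate and the factorization contributes the exact
   solution, so the new error solves the scheme with source [r]. *)
have eE : (1%:M + z *: A) *m ((1%:M + z *: B) *m e k.+1) = e k + r.
  rewrite /e mulmxBr mulmxBr [splitting_scheme _ _ _ _ _ _.+1]iterS.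
  rewrite (splitting_stepK _ tau_ge0 ta1 tb1).
  by rewrite splitting_factorization kE /r -/z; apply/matrixP => i j; rewrite !mxE; ring.
have rK : norm1 r <= K * tau ^+ 2.
  apply: le_trans (norm1D _ _) _; rewrite /K mulrDl; apply: lerD.
    exact: PK.
  apply: le_trans (norm1Z _ _) _; rewrite mulrC; apply: ler_pM.
  - exact: norm1_ge0.
  - exact: cabs1_ge0.
  - apply: le_trans (norm1_mulmx _ _) _; rewrite ler_wpM2l//.
    apply: le_trans (norm1_mulmx _ _) _; rewrite ler_wpM2l//.
    by apply: PM; rewrite kT andbT addr_ge0.
  - by apply: le_trans (cabs1M _ _) _; rewrite cabs1_i// expr2.
have lowB : (1 - tau * b) * norm1 (e k.+1) <= norm1 ((1%:M + z *: B) *m e k.+1).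
  exact: euler_lower_bound.
have lowA : (1 - tau * a) * norm1 ((1%:M + z *: B) *m e k.+1) <= norm1 (e k + r).
  by rewrite -eE; exact: euler_lower_bound.
have low := le_trans lowA (norm1D _ _).
have n0 := norm1_ge0 (e k.+1).
set y := norm1 (e k.+1) in lowB n0 *.
set w := norm1 (_ *m e k.+1) in lowB low.
set x := norm1 (e k) in low *.
set p := L * tau; have p0 : 0 <= p by rewrite mulr_ge0//; lra.
have p4 : 4 * p < 1 by rewrite /p mulrA.
have pb : (1 - p) * y <= w.
  by apply: le_trans lowB; rewrite ler_wpM2r// lerB// /p [L * _]mulrC.
have pa : (1 - p) * w <= x + K * tau ^+ 2.
  apply: le_trans (le_trans low (lerD (lexx _) rK)).
  rewrite ler_wpM2r ?norm1_ge0// lerB// /p [L * _]mulrC//.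
have pab : (1 - p) * ((1 - p) * y) <= x + K * tau ^+ 2.
  by apply: le_trans pa; rewrite ler_wpM2l//; lra.
rewrite -mulrA -/p.
(* The inequality [(1 + 4p)(1 - p)^2 >= 1] replaces division by [(1 - p)^2]; the factor
   [2 - 7p + 4p^2] is positive because [p < 1/4]. *)
apply: (@le_trans _ _ ((1 + 4 * p) * ((1 - p) * ((1 - p) * y)))).
  rewrite -subr_ge0.
  have -> : (1 + 4 * p) * ((1 - p) * ((1 - p) * y)) - y
            = p * (2 - 7 * p + 4 * p ^+ 2) * y by ring.
  by rewrite !mulr_ge0//; nra.
by rewrite ler_wpM2l//; lra.
Qed.

End splitting.

Theorem theorem4p2 (R : realType) (d : nat) (hd : d = 1%N \/ d = 2%N)
    (A1 A2 : 'M[R]_d) (hA1 : A1 \in unitmx) (hA2 : A2 \in unitmx)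
    (hinc : incommensurate A1 A2)
    (v1 v2 : 'cV[R]_d -> R)
    (hv1 : L2loc v1) (hv2 : L2loc v2)
    (hp1 : lattice_periodic A1 v1) (hp2 : lattice_periodic A2 v2)
    (Ec T : R) (hEc : 0 < Ec) (hT : 0 < T)
    (Phi0 : 'cV[R[i]]_(pw_dim A1 A2 Ec))
    (Phi : R -> 'cV[R[i]]_(pw_dim A1 A2 Ec))
    (hPhi : schrodinger_solution (pwH A1 A2 v1 v2 Ec) Phi0 T Phi) :
  exists tau0 CT : R, [/\ 0 < tau0, 0 < CT &
    forall (tau : R) (k : nat), 0 < tau < tau0 -> k%:R * tau <= T ->
      l2norm (Phi (k%:R * tau)
              - splitting_scheme (pwD A1 A2 Ec) (pwV1 A1 A2 v1 Ec) (pwV2 A1 A2 v2 Ec)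
                  tau Phi0 k) <= CT * tau].
(* [pwH] unfolds to the sum of the three matrices, so the general matrix estimate applies as it
   stands. *)
Proof. exact: splitting_convergence hPhi. Qed.
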